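(* Let $m\ge 1$, $n>1$ and $p\ge 3$ be integers. Then $\theta(mC_p[\bar{K_n}])=0$ if $n$ is even, or $mnp$ is odd, or $n$ is odd and $p\equiv 0\pmod 4$; and $\theta(mC_p[\bar{K_n}])=1$ otherwise.
   Context: $C_p$ is the cycle on $p$ vertices and $\bar{K_n}$ is the edgeless graph on $n$ vertices. For graphs $G,H$, the lexicographic product $G[H]$ has vertex set $V(G)\times V(H)$, with $(g,h)$ adjacent to $(g',h')$ iff $gg'\in E(G)$, or $g=g'$ and $hh'\in E(H)$. $mC_p[\bar{K_n}]$ denotes the disjoint union of $m$ copies of $C_p[\bar{K_n}]$. For a finite set $S$ of positive integers with $|S|=|V(G)|$, a graph $G$ is $S$-magic if there is a bijection $f:V(G)\to S$ and a constant $c$ with $\sum_{v\in N(u)} f(v)=c$ for every vertex $u$, where $N(u)$ is the set of neighbours of $u$. Let $\alpha(S)=\max S$ and $i(G)=\min \alpha(S)$ over all $S$ for which $G$ is $S$-magic; the distance magic index is $\theta(G)=i(G)-|V(G)|$ (and $\theta(G)=\infty$ if no such $S$ exists). *)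

(* Defs.v *)
From mathcomp Require Import all_boot all_order all_algebra.
From mathcomp Require Import finmap.
From mathcomp Require Import boolp constructive_ereal.

Set Implicit Arguments.
Unset Strict Implicit.
Unset Printing Implicit Defensive.

Record sgraph : Type := SGraph {
  vertex :> finType;
  adj : rel vertex;
  adj_sym : symmetric adj;
  adj_irrefl : irreflexive adj
}.
Arguments adj {s} _ _.

Section Cycle.
Variable p : nat.

(* The clause i != j only matters for p = 1, where i would be its own
   successor modulo p. *)
Definition cycle_adj : rel 'I_p :=
  fun i j => (i != j) && ((j == i.+1 %% p :> nat) || (i == j.+1 %% p :> nat)).

Lemma cycle_adj_sym : symmetric cycle_adj.
Proof. by move=> i j; rewrite /cycle_adj eq_sym orbC. Qed.

Lemma cycle_adj_irrefl : irreflexive cycle_adj.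
Proof. by move=> i; rewrite /cycle_adj eqxx. Qed.

Definition cycle_graph : sgraph := SGraph cycle_adj_sym cycle_adj_irrefl.
End Cycle.

Section Edgeless.
Variable n : nat.

Definition edgeless_adj : rel 'I_n := fun _ _ => false.

Lemma edgeless_adj_sym : symmetric edgeless_adj.
Proof. by []. Qed.

Lemma edgeless_adj_irrefl : irreflexive edgeless_adj.
Proof. by []. Qed.

Definition edgeless : sgraph := SGraph edgeless_adj_sym edgeless_adj_irrefl.
End Edgeless.

Section Lexicographic.
Variables G H : sgraph.

Definition lex_adj : rel (G * H)%type :=
  fun x y => adj x.1 y.1 || ((x.1 == y.1) && adj x.2 y.2).

Lemma lex_adj_sym : symmetric lex_adj.
Proof.
move=> x y; rewrite /lex_adj adj_sym eq_sym; congr (_ || (_ && _)).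
exact: adj_sym.
Qed.

Lemma lex_adj_irrefl : irreflexive lex_adj.
Proof. by move=> x; rewrite /lex_adj !adj_irrefl andbF. Qed.

Definition lex_product : sgraph := SGraph lex_adj_sym lex_adj_irrefl.
End Lexicographic.

Section Copies.
Variables (m : nat) (G : sgraph).

Definition copies_adj : rel ('I_m * G)%type :=
  fun x y => (x.1 == y.1) && adj x.2 y.2.

Lemma copies_adj_sym : symmetric copies_adj.
Proof. by move=> x y; rewrite /copies_adj eq_sym adj_sym. Qed.

Lemma copies_adj_irrefl : irreflexive copies_adj.
Proof. by move=> x; rewrite /copies_adj adj_irrefl andbF. Qed.

Definition copies : sgraph := SGraph copies_adj_sym copies_adj_irrefl.
End Copies.

Definition S_magic (G : sgraph) (S : {fset nat}) : Prop :=
  [/\ forall x, x \in S -> 0 < x,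
      #|` S| = #|G| &
      exists (f : G -> S) (c : nat),
        bijective f /\ forall u : G, \sum_(v | adj u v) fsval (f v) = c].

Definition alpha (S : {fset nat}) : nat := \max_(x <- S) x.

Definition magic_max (G : sgraph) (a : nat) : Prop :=
  exists S : {fset nat}, S_magic G S /\ alpha S = a.

(* i(G), with value +oo when G is not S-magic for any S. *)
Definition magic_number (G : sgraph) : \bar int :=
  if pselect (exists a, `[< magic_max G a >]) is left ex
  then (Posz (ex_minn ex))%:E else +oo%E.

(* The subtraction is in the integers extended with infinities, so it is not
   truncated. *)
Definition distance_magic_index (G : sgraph) : \bar int :=
  (magic_number G - (Posz #|G|)%:E)%E.

(* Main.v *)
Require Import Defs.
From mathcomp Require Import all_boot all_order all_algebra.
From mathcomp Require Import finmap boolp.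
From mathcomp Require Import constructive_ereal.
From mathcomp Require Import zify.

(** Write G[n] for the graph obtained from G by blowing up every vertex to n
    independent ones (its fibre), and let k = |G|. Since mC_p[n] is the blow-up
    of G = mC_p, a labelling of it is magic iff the fibre sums have constant
    neighbour sum in G.

    Let n > 1. Fill an n x k array by letting row r be a permutation of rk + 1
    .. rk + k, and use its columns as fibres. Two consecutive rows, one
    increasing and one decreasing, contribute equally to all columns; this
    settles n even. For n odd, the first three rows are increasing, of slope -2
    modulo k, and a half turn: the column sums are constant if k is odd, and if
    k is even they take two values differing by 1, on the two halves of the
    columns. Hence G[n] is magic with labels 1 .. kn for every regular G if n is
    even or kn is odd, and also if some set A of vertices contains half of every
    neighbourhood: double counting gives |A| = k/2, and the columns of larger
    sum are assigned to A. In mC_p with 4 | p, such a set consists of the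
    vertices i with i mod 4 < 2.

    Conversely, a constant neighbour sum in C_p means s_i + s_(i+2) = c, hence
    s_i = s_(i+4), and if 4 does not divide p all s_i are equal. With labels
    1 .. kn their common value is n (kn + 1) / 2, which is not an integer for n
    odd and k even. In that case one skipped label suffices. *)

Set Implicit Arguments.
Unset Strict Implicit.
Unset Printing Implicit Defensive.

Definition neighbour_sum (G : sgraph) (f : G -> nat) (u : G) : nat :=
  \sum_(v | adj u v) f v.

Lemma eq_neighbour_sum (G : sgraph) (f g : G -> nat) u :
  f =1 g -> neighbour_sum f u = neighbour_sum g u.
Proof. by move=> fg; apply: eq_bigr. Qed.

Lemma neighbour_sumD (G : sgraph) (f g : G -> nat) u :
  neighbour_sum (fun v => f v + g v) u = neighbour_sum f u + neighbour_sum g u.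
Proof. exact: big_split. Qed.

Lemma neighbour_sum_const (G : sgraph) a (u : G) :
  neighbour_sum (fun=> a) u = #|adj u| * a.
Proof. by rewrite -sum_nat_const. Qed.

Lemma neighbour_sum_mem (G : sgraph) (A : {pred G}) u :
  neighbour_sum (fun v => (v \in A) : nat) u = #|[predI adj u & A]|.
Proof.
rewrite -sum1_card /neighbour_sum big_mkcondr /=.
by apply: eq_bigr => v _; case: (v \in A).
Qed.

Definition regular (G : sgraph) (d : nat) : Prop := forall u : G, #|adj u| = d.

Lemma neighbour_sum_regular (G : sgraph) d a (u : G) :
  regular G d -> neighbour_sum (fun=> a) u = d * a.
Proof. by move=> regG; rewrite neighbour_sum_const regG. Qed.

Definition magic_within (G : sgraph) (M : nat) : Prop :=
  exists (f : G -> nat) (c : nat),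
    [/\ injective f, forall v, 0 < f v <= M &
        forall u, neighbour_sum f u = c].

Lemma magic_max_within (G : sgraph) a : magic_max G a -> magic_within G a.
Proof.
case=> S [[S_gt0 _ [f [c [f_bij f_sum]]]] <-].
exists (fun v => fsval (f v)), c; split=> // [u v /val_inj|v].
  exact: bij_inj f_bij u v.
rewrite S_gt0 ?fsvalP //=.
exact: (@leq_bigmax_seq _ _ xpredT id _ (fsvalP (f v)) isT).
Qed.

Lemma magic_within_max (G : sgraph) M :
  magic_within G M -> exists2 a, a <= M & magic_max G a.
Proof.
case=> f [c [f_inj f_bounds f_sum]].
pose S : {fset nat} := [fset x in codom f]%fset.
have fS v : f v \in S by rewrite in_fset /= codom_f.
have S_bounds x : x \in S -> 0 < x <= M.
  by rewrite in_fset /= => /codomP[v ->].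
have cardS : #|` S| = #|G|.
  by rewrite card_fseq undup_id ?size_codom //; apply/injectiveP.
exists (alpha S); first by apply/bigmax_leqP_seq => x /S_bounds /andP[].
exists S; split=> //; split=> //; first by move=> x /S_bounds /andP[].
exists (fun v => [` fS v]%fset), c; split=> //.
apply: inj_card_bij; first by move=> u v /(congr1 val) /= /f_inj.
by rewrite -cardfE cardS.
Qed.

Lemma codom_sub_iota1 (T : finType) (f : T -> nat) M :
  (forall v, 0 < f v <= M) -> {subset codom f <= iota 1 M}.
Proof. by move=> f_bounds _ /codomP[v ->]; rewrite mem_iota add1n ltnS. Qed.

Lemma magic_within_ge_card (G : sgraph) M : magic_within G M -> #|G| <= M.
Proof.
case=> f [c [/injectiveP f_uniq /codom_sub_iota1 f_sub _]].
by rewrite -(size_codom f) -(size_iota 1 M); apply: uniq_leq_size.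
Qed.

Lemma sum_injective_labels (T : finType) (f : T -> nat) :
  injective f -> (forall v, 0 < f v <= #|T|) ->
  \sum_v f v = 'C(#|T|.+1, 2).
Proof.
move=> /injectiveP f_uniq /codom_sub_iota1 f_sub.
have size_le : size (iota 1 #|T|) <= size (codom f).
  by rewrite size_iota size_codom.
have [_ mem_codom] := uniq_min_size f_uniq f_sub size_le.
have perm_codom := uniq_perm f_uniq (iota_uniq _ _) mem_codom.
by rewrite -bin2_sum big_ltn // add0n /index_iota subn1 -(perm_big _ perm_codom)
  big_image.
Qed.

Lemma distance_magic_indexE (G : sgraph) d :
  magic_within G (#|G| + d) ->
  (forall e, e < d -> ~ magic_within G (#|G| + e)) ->
  distance_magic_index G = (Posz d)%:E.
Proof.
move=> /magic_within_max[a le_a max_a] min_d.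
have d_le b : magic_max G b -> #|G| + d <= b.
  move=> /magic_max_within within_b.
  have ge_card := magic_within_ge_card within_b.
  rewrite -(subnKC ge_card) leq_add2l leqNgt; apply/negP => /min_d.
  by rewrite subnKC.
have {le_a}a_eq : a = #|G| + d by apply/eqP; rewrite eqn_leq le_a d_le.
rewrite /distance_magic_index /magic_number.
case: pselect => [ex|[]]; last by exists a; apply/asboolP.
case: ex_minnP => b /asboolP /d_le d_le_b b_min.
have -> : b = #|G| + d.
  by apply/eqP; rewrite eqn_leq d_le_b andbT -a_eq b_min //; apply/asboolP.
by rewrite -EFinB; congr EFin; lia.
Qed.

Lemma distance_magic_index_eq0 (G : sgraph) :
  magic_within G #|G| -> distance_magic_index G = 0%:E.
Proof.
by move=> within_card; apply: (@distance_magic_indexE _ 0); rewrite ?addn0.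
Qed.

Lemma distance_magic_index_eq1 (G : sgraph) :
  ~ magic_within G #|G| -> magic_within G #|G|.+1 ->
  distance_magic_index G = 1%:E.
Proof.
move=> not_card within_cardS.
apply: (@distance_magic_indexE _ 1) => [|e]; first by rewrite addn1.
by rewrite ltnS leqn0 => /eqP->; rewrite addn0.
Qed.

Definition isomorphic (G H : sgraph) : Prop :=
  exists2 h : G -> H, bijective h & forall u v, adj (h u) (h v) = adj u v.

Lemma isomorphic_sym (G H : sgraph) : isomorphic G H -> isomorphic H G.
Proof.
case=> h [h' hK h'K] adj_h; exists h'; first by exists h.
by move=> u v; rewrite -adj_h !h'K.
Qed.

Lemma isomorphic_card (G H : sgraph) : isomorphic G H -> #|G| = #|H|.
Proof. by case=> h /bij_eq_card. Qed.

Lemma S_magic_isomorphic (G H : sgraph) S :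
  isomorphic G H -> S_magic H S -> S_magic G S.
Proof.
move=> isoGH [S_gt0 cardS [f [c [f_bij f_sum]]]].
split=> //; first by rewrite (isomorphic_card isoGH).
case: isoGH => h h_bij adj_h.
exists (f \o h), c; split=> [|u]; first exact: bij_comp.
rewrite -(f_sum (h u)) [RHS](reindex h) /=; last exact: onW_bij.
by apply: eq_bigl => v; rewrite adj_h.
Qed.

Lemma distance_magic_index_isomorphic (G H : sgraph) :
  isomorphic G H -> distance_magic_index G = distance_magic_index H.
Proof.
move=> isoGH.
have eq_max : magic_max G = magic_max H.
  apply/funext => a; apply/propext.
  split=> -[S [S_mag <-]]; exists S; split=> //.
    exact: S_magic_isomorphic (isomorphic_sym isoGH) S_mag.
  exact: S_magic_isomorphic isoGH S_mag.
by rewrite /distance_magic_index /magic_number eq_max (isomorphic_card isoGH).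
Qed.

Lemma copies_lex_product_isomorphic m (G H : sgraph) :
  isomorphic (copies m (lex_product G H)) (lex_product (copies m G) H).
Proof.
exists (fun v => ((v.1, v.2.1), v.2.2)).
  by exists (fun v => (v.1.1, (v.1.2, v.2))) => [[a [x r]]|[[a x] r]].
move=> [a [x r]] [b [y s]]; rewrite /= /lex_adj /copies_adj /= /lex_adj /=.
by rewrite xpair_eqE andb_orr andbA.
Qed.

Definition blowup (G : sgraph) (n : nat) : sgraph := lex_product G (edgeless n).

Lemma card_blowup G n : #|blowup G n| = #|G| * n.
Proof. by rewrite card_prod card_ord. Qed.

Definition fibre_sum (G : sgraph) n (f : blowup G n -> nat) (x : G) : nat :=
  \sum_(r < n) f (x, r).

Lemma blowup_neighbour_sum (G : sgraph) n (f : blowup G n -> nat) x r :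
  neighbour_sum f (x, r) = neighbour_sum (fibre_sum f) x.
Proof.
rewrite /neighbour_sum /fibre_sum pair_big_dep /=.
by apply: eq_big => [[y s]|[y s] _] //; rewrite /= /lex_adj andbF orbF andbT.
Qed.

Lemma sum_fibre_sum (G : sgraph) n (f : blowup G n -> nat) :
  \sum_x fibre_sum f x = \sum_v f v.
Proof. by rewrite /fibre_sum pair_bigA; apply: eq_bigr => -[]. Qed.

Definition neighbour_sum_rigid (G : sgraph) : Prop :=
  forall (s : G -> nat) c,
    (forall u, neighbour_sum s u = c) -> forall v w, s v = s w.

Lemma rigid_blowup_not_magic_within_card (G : sgraph) n :
  neighbour_sum_rigid G -> 0 < #|G| -> ~~ odd #|G| -> odd n ->
  ~ magic_within (blowup G n) #|blowup G n|.
Proof.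
move=> rigidG G_gt0 evenG odd_n [f [c [f_inj f_bounds f_sum]]].
have n_gt0 : 0 < n by case: (n) odd_n.
have [v0 _] := card_gt0P G_gt0.
have fibre_const x : fibre_sum f x = fibre_sum f v0.
  apply: (rigidG _ c) => u.
  by rewrite -(f_sum (u, Ordinal n_gt0)) blowup_neighbour_sum.
have := sum_injective_labels f_inj f_bounds.
rewrite -sum_fibre_sum (eq_bigr _ (fun x _ => fibre_const x)) sum_nat_const.
rewrite card_blowup => total.
have : #|G| * (fibre_sum f v0).*2 = #|G| * (n * (#|G| * n).+1).
  by rewrite -mul2n mulnCA total -mul_bin_diag bin1 /= mulnC mulnA.
move/eqP; rewrite eqn_pmul2l // => /eqP /(congr1 odd).
by rewrite odd_double oddM odd_n oddS oddM (negPf evenG).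
Qed.

Definition permutes (k : nat) (s : nat -> nat) : Prop :=
  (forall x, x < k -> s x < k) /\ {in gtn k &, injective s}.

Definition boustrophedon k r x := if odd r then x else k.-1 - x.

Definition zigzag k x :=
  if x.*2 < k then k.-1 - x.*2 else k.*2 - (~~ odd k).+1 - x.*2.

Definition half_turn k x := if x + k./2 < k then x + k./2 else x + k./2 - k.

Definition row k n r : nat -> nat :=
  if odd n then
    match r with
    | 0 => id
    | 1 => zigzag k
    | 2 => half_turn k
    | r'.+3 => boustrophedon k r'
    end
  else boustrophedon k r.

Lemma boustrophedon_permutes k r : permutes k (boustrophedon k r).
Proof.
by rewrite /boustrophedon; case: odd; split=> [x|x y]; rewrite ?inE; lia.
Qed.

Lemma zigzag_permutes k : permutes k (zigzag k).
Proof. by split=> [x|x y]; rewrite ?inE /zigzag; do !case: ifP; lia. Qed.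

Lemma half_turn_permutes k : permutes k (half_turn k).
Proof. by split=> [x|x y]; rewrite ?inE /half_turn; do !case: ifP; lia. Qed.

Lemma row_permutes k n r : permutes k (row k n r).
Proof.
rewrite /row; case: odd; last exact: boustrophedon_permutes.
case: r => [|[|[|r]]]; first by split.
- exact: zigzag_permutes.
- exact: half_turn_permutes.
- exact: boustrophedon_permutes.
Qed.

Lemma boustrophedon_sum k q x : x < k ->
  \sum_(r < q.*2) boustrophedon k r x = q * k.-1.
Proof.
move=> x_lt; elim: q => [|q IHq]; first by rewrite big_ord0.
rewrite doubleS !big_ord_recr /= IHq /boustrophedon /= odd_double /=; lia.
Qed.

Lemma id_zigzag_half_turn_sum k x : x < k ->
  x + (zigzag k x + half_turn k x) + (~~ odd k && (k./2 <= x))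
  = 3 * k./2 - ~~ odd k.
Proof. by rewrite /zigzag /half_turn; do !case: ifP; lia. Qed.

Definition deficient k n x := [&& odd n, ~~ odd k & k./2 <= x].

Lemma row_sum k n x : n != 1 -> x < k ->
  \sum_(r < n) row k n r x + deficient k n x
  = if odd n then 3 * k./2 - ~~ odd k + (n - 3)./2 * k.-1 else n./2 * k.-1.
Proof.
move=> n_neq1 x_lt; rewrite /row /deficient.
case: ifP => odd_n; last first.
  by rewrite -(boustrophedon_sum _ x_lt) even_halfK ?odd_n ?addn0.
have n_eq : n = ((n - 3)./2).*2.+3 by lia.
rewrite [in LHS]n_eq !big_ord_recl /= boustrophedon_sum //.
by rewrite -(id_zigzag_half_turn_sum x_lt); lia.
Qed.

Definition entry k n x r := (r * k + row k n r x).+1.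

Lemma entry_bounds k n x r : x < k -> r < n -> 0 < entry k n x r <= k * n.
Proof.
move=> x_lt r_lt; have := (row_permutes k n r).1 x x_lt.
by rewrite /entry; nia.
Qed.

Lemma entry_inj k n x y r t : x < k -> y < k ->
  entry k n x r = entry k n y t -> x = y /\ r = t.
Proof.
move=> x_lt y_lt [] eq_entry.
have k_gt0 : 0 < k by apply: leq_ltn_trans x_lt.
have row_lt z i : z < k -> row k n i z < k by apply: (row_permutes k n i).1.
have eq_rt : r = t.
  move: (congr1 (divn^~ k) eq_entry).
  by rewrite /= !divnMDl // !divn_small ?addn0 ?row_lt.
split=> //; move: eq_entry; rewrite eq_rt => /addnI.
exact: (row_permutes k n t).2.
Qed.

Definition column_sum k n (s : nat -> nat) x := \sum_(r < n) s (entry k n x r).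

Lemma column_sum_deficient k n : n != 1 ->
  exists D, forall x, x < k -> column_sum k n id x + deficient k n x = D.
Proof.
move=> n_neq1; eexists => x x_lt.
have -> : column_sum k n id x =
    \sum_(r < n) (r * k).+1 + \sum_(r < n) row k n r x.
  by rewrite -big_split; apply: eq_bigr.
by rewrite -addnA row_sum.
Qed.

Lemma column_sum_bump k n x : odd n -> x < k ->
  column_sum k n (bump (k./2).+1) x
  = n.-1 + (k./2 <= x) + column_sum k n id x.
Proof.
case: n => // n odd_n x_lt; rewrite /column_sum big_split; congr (_ + _).
rewrite big_ord_recl addnC; congr (_ + _); first by rewrite /entry /row odd_n.
rewrite -[RHS]card_ord -sum1_card; apply: eq_bigr => r _.
suff -> : k./2 < entry k n.+1 x (lift ord0 r) by [].
by rewrite /entry /= /bump /=; nia.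
Qed.

Definition ranking (T : finType) (phi : T -> nat) : Prop :=
  injective phi /\ forall x, phi x < #|T|.

Lemma enum_rank_ranking (T : finType) : ranking (fun x : T => enum_rank x).
Proof. by split=> [x y /val_inj /enum_rank_inj|x]. Qed.

Lemma ranking_initial (T : finType) (A : {pred T}) :
  exists2 phi : T -> nat, ranking phi & forall x, (phi x < #|A|) = (x \in A).
Proof.
pose s := enum A ++ enum [predC A].
have mem_s x : x \in s by rewrite mem_cat !mem_enum inE /= orbN.
exists (index^~ s) => [|x]; first split=> [x y eq_index|x].
- by rewrite -(nth_index x (mem_s x)) eq_index nth_index.
- by rewrite -(cardC A) !cardE -size_cat index_mem.
rewrite index_cat mem_enum cardE; case: ifP => xA.
  by rewrite index_mem mem_enum.
by rewrite ltnNge leq_addr.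
Qed.

Lemma magic_within_blowup (G : sgraph) n phi (s : nat -> nat) M c :
  ranking phi -> injective s ->
  (forall l, 0 < l <= #|G| * n -> 0 < s l <= M) ->
  (forall u : G, neighbour_sum (column_sum #|G| n s \o phi) u = c) ->
  magic_within (blowup G n) M.
Proof.
move=> [phi_inj phi_lt] s_inj s_bounds sum_c.
exists (fun v : blowup G n => s (entry #|G| n (phi v.1) v.2)), c; split.
- by move=> [x r] [y t] /s_inj /entry_inj[] //= /phi_inj -> /val_inj ->.
- by move=> [x r]; apply/s_bounds/entry_bounds.
by move=> [x r]; rewrite blowup_neighbour_sum -(sum_c x).
Qed.

Lemma deficient_blowup_magic_within_card (G : sgraph) n d phi e :
  regular G d -> n != 1 -> ranking phi ->
  (forall u : G,
    neighbour_sum (fun v => deficient #|G| n (phi v) : nat) u = e) ->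
  magic_within (blowup G n) #|blowup G n|.
Proof.
move=> regG n_neq1 phi_ranking sum_e; rewrite card_blowup.
have [D col_D] := column_sum_deficient #|G| n_neq1.
apply: (magic_within_blowup (s := id) (c := d * D - e) phi_ranking) => // u.
rewrite -(neighbour_sum_regular D u regG) -(sum_e u).
rewrite -(eq_neighbour_sum _ (fun v => col_D _ (phi_ranking.2 v))).
by rewrite neighbour_sumD addnK.
Qed.

Lemma regular_blowup_magic_within_card (G : sgraph) n d :
  regular G d -> n != 1 -> ~~ odd n || odd #|G| ->
  magic_within (blowup G n) #|blowup G n|.
Proof.
move=> regG n_neq1 parity.
apply: (deficient_blowup_magic_within_card (e := 0) regG n_neq1
          (enum_rank_ranking G)) => u.
by apply: big1 => v _; rewrite /deficient; move: parity; case: odd => //= ->.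
Qed.

(* For n odd, row 0 of the array lists the labels 1 .. k, so adding 1 to every
   label above k/2 spares exactly one label of each column that is not
   deficient, and none of the others. *)
Lemma regular_blowup_magic_within_cardS (G : sgraph) n d :
  regular G d -> odd n -> n != 1 -> ~~ odd #|G| ->
  magic_within (blowup G n) #|blowup G n|.+1.
Proof.
move=> regG odd_n n_neq1 evenG; rewrite card_blowup.
have [D col_D] := column_sum_deficient #|G| n_neq1.
apply: (magic_within_blowup (s := bump (#|G|./2).+1) (c := d * (n.-1 + D))
          (enum_rank_ranking G)).
- exact: can_inj (bumpK _).
- by move=> l; rewrite /bump; lia.
move=> u; rewrite -(neighbour_sum_regular _ u regG).
apply: eq_neighbour_sum => v /=; rewrite column_sum_bump //.
rewrite -(col_D (enum_rank v)) // /deficient odd_n evenG /=.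
by rewrite -addnA [_ + column_sum _ _ _ _]addnC.
Qed.

Definition halves_neighbourhoods (G : sgraph) (A : {pred G}) : Prop :=
  forall u : G, #|[predI adj u & A]|.*2 = #|adj u|.

Lemma halves_neighbourhoodsC (G : sgraph) (A : {pred G}) :
  halves_neighbourhoods A -> halves_neighbourhoods [predC A].
Proof.
move=> halvesA u; rewrite -[RHS]halvesA; congr _.*2.
apply: (@addnI #|[predI adj u & A]|); rewrite [RHS]addnn halvesA.
rewrite -[RHS](cardID A); congr (_ + _).
by apply: eq_card => v; rewrite !inE andbC.
Qed.

Lemma sum_card_neighbours_in (G : sgraph) (A : {pred G}) :
  \sum_u #|[predI adj u & A]| = \sum_(v in A) #|adj v|.
Proof.
under eq_bigr => u _ do rewrite -sum1_card.
rewrite (exchange_big_dep [in A]) /=; last by move=> u v _ /andP[].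
apply: eq_bigr => v vA; rewrite -sum1_card.
by apply: eq_bigl => u; rewrite !inE vA andbT; apply: adj_sym.
Qed.

Lemma card_halving_set (G : sgraph) d (A : {pred G}) :
  regular G d -> 0 < d -> halves_neighbourhoods A -> #|A|.*2 = #|G|.
Proof.
move=> regG d_gt0 halvesA; apply/eqP; rewrite -(eqn_pmul2r d_gt0); apply/eqP.
have <- : \sum_(u : G) #|adj u| = #|G| * d.
  by rewrite (eq_bigr _ (fun u _ => regG u)) sum_nat_const.
under eq_bigr => u _ do rewrite -halvesA -muln2.
rewrite -big_distrl /= sum_card_neighbours_in.
by rewrite (eq_bigr _ (fun u _ => regG u)) sum_nat_const muln2 doubleMl.
Qed.

Lemma halving_blowup_magic_within_card (G : sgraph) n d (A : {pred G}) :
  regular G d -> 0 < d -> halves_neighbourhoods A -> n != 1 ->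
  magic_within (blowup G n) #|blowup G n|.
Proof.
move=> regG d_gt0 halvesA n_neq1.
have cardA := card_halving_set regG d_gt0 halvesA.
case: (boolP (~~ odd n || odd #|G|)) => [parity|].
  exact: regular_blowup_magic_within_card regG n_neq1 parity.
rewrite negb_or negbK => /andP[odd_n evenG].
have [phi phi_ranking phi_A] := ranking_initial A.
apply: (deficient_blowup_magic_within_card (e := d./2) regG n_neq1
          phi_ranking) => u.
rewrite -(regG u) -(halves_neighbourhoodsC halvesA) doubleK -neighbour_sum_mem.
apply: eq_neighbour_sum => v.
by rewrite /deficient odd_n evenG -cardA doubleK leqNgt phi_A.
Qed.

Lemma copies_neighbour_sum m (G : sgraph) (f : copies m G -> nat) a x :
  neighbour_sum f (a, x) = neighbour_sum (fun y => f (a, y)) x.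
Proof.
transitivity (\sum_(b | b == a) \sum_(y | adj x y) f (b, y)); last first.
  exact: big_pred1_eq.
rewrite /neighbour_sum pair_big_dep /=.
by apply: eq_big => [[b y]|[b y] _] //; rewrite /= /copies_adj /= eq_sym.
Qed.

Lemma iter_ordS_val p (i : 'I_p) d : iter d (@ordS p) i = (i + d) %% p :> nat.
Proof.
elim: d => [|d IHd]; first by rewrite addn0 modn_small.
by rewrite iterS /= IHd -addn1 modnDml -addnA addn1.
Qed.

Lemma iter_ordS_eq p (i : 'I_p) d : (iter d (@ordS p) i == i) = (p %| d).
Proof.
rewrite -val_eqE /= iter_ordS_val -[X in _ == X](modn_small (ltn_ord i)).
by rewrite -[X in _ == X %% _]addn0 eqn_modDl mod0n.
Qed.

Lemma cycle_adjE p (i j : 'I_p) : 1 < p ->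
  cycle_adj i j = (j == ord_pred i) || (j == ordS i).
Proof.
move=> p_gt1; have ordS_neq (x : 'I_p) : ordS x != x.
  by have := iter_ordS_eq x 1; rewrite /= dvdn1 => ->; lia.
have predE : (j == ord_pred i) = (i == ordS j).
  by rewrite [in RHS]eq_sym (can2_eq (@ordSK p) (@ord_predK p)).
rewrite predE orbC /cycle_adj -![(_ == _ %% p :> nat)]/(_ == ordS _).
have [<-|//] := eqVneq i j.
by rewrite ![i == _]eq_sym (negPf (ordS_neq i)).
Qed.

Lemma cycle_neighbour_sum p (f : cycle_graph p -> nat) (i : 'I_p) :
  2 < p -> neighbour_sum f i = f (ord_pred i) + f (ordS i).
Proof.
move=> p_gt2; rewrite /neighbour_sum (bigD1 (ord_pred i)) /=; last first.
  by rewrite cycle_adjE ?eqxx // ltnW.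
congr (_ + _); apply: big_pred1 => j; rewrite cycle_adjE ?(ltnW p_gt2) //.
rewrite andb_orl andbN /=; have [->|//] := eqVneq j (ordS i).
have := iter_ordS_eq (ord_pred i) 2; rewrite /= ord_predK => ->.
by rewrite gtnNdvd.
Qed.

Lemma copies_cycle_neighbour_sum m p (f : copies m (cycle_graph p) -> nat) a i :
  2 < p -> neighbour_sum f (a, i) = f (a, ord_pred i) + f (a, ordS i).
Proof. by move=> p_gt2; rewrite copies_neighbour_sum cycle_neighbour_sum. Qed.

Lemma card_copies_cycle m p : #|copies m (cycle_graph p)| = m * p.
Proof. by rewrite card_prod !card_ord. Qed.

Lemma copies_cycle_regular m p : 2 < p -> regular (copies m (cycle_graph p)) 2.
Proof.
move=> p_gt2 [a i]; rewrite -[LHS]muln1 -neighbour_sum_const.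
exact: copies_cycle_neighbour_sum.
Qed.

Lemma copies_cycle_halving_set m p : 2 < p -> 4 %| p ->
  halves_neighbourhoods [pred v : copies m (cycle_graph p) | v.2 %% 4 < 2].
Proof.
move=> p_gt2 dvd4p [a i]; rewrite copies_cycle_regular // -neighbour_sum_mem.
rewrite copies_cycle_neighbour_sum // -[in ordS i](ord_predK i) !inE /=.
by rewrite !modn_dvdm //; lia.
Qed.

Lemma periodic_two_step_sum_double (t : nat -> nat) p c :
  p != 0 %[mod 4] -> (forall j, t (j + p) = t j) ->
  (forall j, t j + t j.+2 = c) -> (t 0).*2 = c.
Proof.
move=> p_mod4 t_periodic t_sum.
have t_mod4 q j : t (j + 4 * q) = t j.
  elim: q => [|q <-]; first by rewrite addn0.
  have -> : j + 4 * q.+1 = (j + 4 * q).+4 by lia.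
  by have := t_sum (j + 4 * q).+2; have := t_sum (j + 4 * q); lia.
have t_modp w : t (p * w) = t 0.
  by elim: w => [|w IHw]; rewrite ?muln0 // mulnSr t_periodic.
have t2 : t 2 = t 0.
  pose w := (odd p).+1.
  rewrite -(t_modp w) -(t_mod4 ((p * w) %/ 4) 2); congr t.
  by rewrite /w; case: (boolP (odd p)); lia.
by rewrite -addnn -[in X in _ + X]t2.
Qed.

Lemma copies_cycle_rigid m p : 2 < p -> p != 0 %[mod 4] ->
  neighbour_sum_rigid (copies m (cycle_graph p)).
Proof.
move=> p_gt2 p_mod4 s c s_sum.
suff double_s v : (s v).*2 = c.
  by move=> v w; apply: double_inj; rewrite !double_s.
case: v => a i; pose t j := s (a, iter j (@ordS p) i).
have iter_p : iter p (@ordS p) i = i by apply/eqP; rewrite iter_ordS_eq.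
apply: (periodic_two_step_sum_double (t := t) p_mod4) => j; rewrite /t.
  by rewrite iterD iter_p.
rewrite -(s_sum (a, iter j.+1 (@ordS p) i)) copies_cycle_neighbour_sum //=.
by rewrite ordSK.
Qed.

Theorem theorem14 (m n p : nat) (hm : 1 <= m) (hn : 1 < n) (hp : 3 <= p) :
  let theta :=
    distance_magic_index (copies m (lex_product (cycle_graph p) (edgeless n))) in
  let C :=
    ~~ odd n \/ odd (m * n * p) \/ (odd n /\ p = 0 %[mod 4]) in
  (C -> theta = 0%:E) /\ (~ C -> theta = 1%:E).
Proof.
move=> theta C; pose G := copies m (cycle_graph p).
have -> : theta = distance_magic_index (blowup G n).
  apply: distance_magic_index_isomorphic.
  exact: copies_lex_product_isomorphic.
have regG : regular G 2 := copies_cycle_regular hp.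
have cardG : #|G| = m * p := card_copies_cycle m p.
have n_neq1 : n != 1 by rewrite gtn_eqF.
split=> [holdsC|notC].
  apply: distance_magic_index_eq0.
  have [parity|/eqP dvd4p] : ~~ odd n || odd #|G| \/ p = 0 %[mod 4].
    case: holdsC => [->|[odd_mnp|[_ p_mod4]]]; [by left| |by right].
    by left; rewrite cardG; move: odd_mnp; rewrite !oddM; case: odd; case: odd.
  - exact: regular_blowup_magic_within_card regG n_neq1 parity.
  - apply: halving_blowup_magic_within_card regG isT _ n_neq1.
    exact: copies_cycle_halving_set.
have odd_n : odd n by apply: contra_notT notC => evenn; left.
have evenG : ~~ odd #|G|.
  rewrite cardG; apply: contra_notN notC => odd_mp.
  by right; left; rewrite mulnAC oddM odd_mp.
have p_mod4 : p != 0 %[mod 4] by apply: contra_notN notC => /eqP; right; right.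
apply: distance_magic_index_eq1.
- apply: rigid_blowup_not_magic_within_card => //; last by rewrite cardG; nia.
  exact: copies_cycle_rigid.
- exact: regular_blowup_magic_within_cardS regG odd_n n_neq1 evenG.
Qed.
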